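(* Let $F:\mathbb{R}\to\mathbb{R}$ be a differentiable flux function, let $\Delta x,\Delta t>0$, and consider the first order, fully discrete scheme $$C_j^{n+1}=C_j^n-\frac{\Delta t}{\Delta x}\left(\mathcal F_{j+\frac12}^n-\mathcal F_{j-\frac12}^n\right),\qquad j\in\mathbb{Z}.$$ (1) (Symmetric speeds.) Suppose that for every $j$ $$\mathcal F_{j-\frac12}^n=F(C_{j-1}^n)+\frac12\left[\left(F(C_j^n)-F(C_{j-1}^n)\right)-a_{j-\frac12}\left(C_j^n-C_{j-1}^n\right)\right].$$ Then the scheme is monotone under the local subcharacteristic condition $$a_{j-\frac12}\ge |F'(C_{j-1}^n)|\quad\text{and}\quad a_{j-\frac12}\ge |F'(C_j^n)|\qquad\text{for all } j,$$ and the time step restriction $\frac{\Delta t}{\Delta x}a_{\max}\le 1$. (2) (Optimal speeds.) Suppose that for every $j$ $$\mathcal F_{j-\frac12}^n=F(C_{j-1}^n)+\frac{-a_{j-\frac12}^-}{a_{j-\frac12}^+-a_{j-\frac12}^-}\left[F(C_j^n)-F(C_{j-1}^n)-a_{j-\frac12}^+\left(C_j^n-C_{j-1}^n\right)\right].$$ Then the scheme is monotone under the local subcharacteristic condition $$a_{j-\frac12}^-\le\min\left(F'(C_{j-1}^n),0\right)\quad\text{and}\quad a_{j-\frac12}^+\ge\max\left(F'(C_j^n),0\right)\qquad\text{for all } j,$$ and the time step restriction $\frac{\Delta t}{\Delta x}a_{\max}\le\frac12$.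
   Context: The scheme approximates the scalar conservation law $C_t+F(C)_x=0$ on a uniform grid with cells indexed by $j\in\mathbb{Z}$, cell width $\Delta x$ and time step $\Delta t$; $C_j^n$ is the approximate cell average in cell $j$ at time level $n$. Local subcharacteristic speeds: at each time step, each cell interface $j-\frac12$ carries real numbers, which are $a_{j-\frac12}\ge 0$ in the symmetric case (corresponding to $a^+_{j-\frac12}=-a^-_{j-\frac12}=a_{j-\frac12}$), and $a_{j-\frac12}^-\le 0\le a_{j-\frac12}^+$ with $a_{j-\frac12}^+-a_{j-\frac12}^->0$ in the optimal case. The speeds are piecewise constant and are reset at every time step. $a_{\max}$ denotes the maximum subcharacteristic speed: $a_{\max}=\sup_j a_{j-\frac12}$ in the symmetric case, and $a_{\max}=\sup_j\max(a_{j-\frac12}^+,|a_{j-\frac12}^-|)$ in the optimal case (assumed finite). Monotone: write the update as $C_j^{n+1}=H(C^n;j)$, where $C^n=(C_i^n)_{i\in\mathbb{Z}}$. The scheme is monotone if $\frac{\partial H(C^n;j)}{\partial C_i^n}\ge 0$ for all $i,j$ and all $C^n$. Here the partial derivatives are taken with the subcharacteristic speeds held fixed (treated as constants), and the inequality is asserted at every $C^n$ and every choice of speeds satisfying the stated subcharacteristic condition and time step restriction. *)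

(* Defs.v *)
From mathcomp Require Import all_boot all_order all_algebra.
From mathcomp Require Import all_classical all_reals all_analysis.

Set Implicit Arguments.
Unset Strict Implicit.
Unset Printing Implicit Defensive.

Import Order.TTheory GRing.Theory Num.Theory.
Import numFieldNormedType.Exports.

Local Open Scope classical_set_scope.
Local Open Scope ring_scope.

(* Cells are indexed by j : int. Quantities attached to interfaces are indexed
   by the cell on their right: index j stands for the interface j - 1/2, and
   index j + 1 for the interface j + 1/2. *)

Definition sym_flux (R : realType) (F : R -> R) (a : int -> R)
    (C : int -> R) (j : int) : R :=
  F (C (j - 1))
  + 1 / 2 * ((F (C j) - F (C (j - 1))) - a j * (C j - C (j - 1))).

Definition opt_flux (R : realType) (F : R -> R) (am ap : int -> R)
    (C : int -> R) (j : int) : R :=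
  F (C (j - 1))
  + - am j / (ap j - am j)
    * (F (C j) - F (C (j - 1)) - ap j * (C j - C (j - 1))).

(* The update C^n |-> C^{n+1}; the speeds are reset at every time step, so one
   step is described by one choice of speeds, contained in [flux]. *)
Definition update (R : realType) (dx dt : R) (flux : (int -> R) -> int -> R)
    (C : int -> R) (j : int) : R :=
  C j - dt / dx * (flux C (j + 1) - flux C j).

Definition sym_amax (R : realType) (a : int -> R) : R := sup (range a).

Definition opt_speed (R : realType) (am ap : int -> R) (j : int) : R :=
  Num.max (ap j) `|am j|.

Definition opt_amax (R : realType) (am ap : int -> R) : R :=
  sup (range (opt_speed am ap)).

(* The section of [H] through C obtained by letting only C_i vary; its
   derivative at C_i is the partial derivative d H(C; j) / d C_i. *)
Definition section_at (R : realType) (H : (int -> R) -> int -> R)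
    (C : int -> R) (i j : int) : R -> R :=
  fun x => H (fun k => if k == i then x else C k) j.

(* [derivable] is required because [derive1] is total: without it, the sign
   condition alone would not assert that the partial derivative exists. *)
Definition monotone_at (R : realType) (H : (int -> R) -> int -> R)
    (C : int -> R) : Prop :=
  forall i j : int,
    derivable (section_at H C i j) (C i) 1 /\
    0 <= derive1 (section_at H C i j) (C i).

(* Main.v *)
(* Both numerical fluxes are, at each interface, affine combinations
   p F(C_(j-1)) + q F(C_j) + r C_(j-1) + s C_j of the neighbouring states.
   Hence the update depends on C_(j-1), C_j, C_(j+1) only, and monotonicity
   amounts to three sign conditions: the flux does not decrease in its left
   argument, does not increase in its right argument, and dt/dx times the sum
   of the two slopes seen by cell j is at most 1. *)

Require Import Defs.
From mathcomp Require Import all_boot all_order all_algebra.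
From mathcomp Require Import all_classical all_reals all_analysis.
From mathcomp Require Import zify ring lra.

Set Implicit Arguments.
Unset Strict Implicit.
Unset Printing Implicit Defensive.

Import Order.TTheory GRing.Theory Num.Theory.
Import numFieldNormedType.Exports.

Local Open Scope classical_set_scope.
Local Open Scope ring_scope.

Section AffineFlux.
Context (R : realType) (F : R -> R) (F_diff : forall x : R, derivable F x 1).

Definition affine_flux (p q r s : int -> R) (C : int -> R) (j : int) : R :=
  p j * F (C (j - 1)) + q j * F (C j) + r j * C (j - 1) + s j * C j.

(** Writing the derivative as a Kronecker delta gives one formula for all [i]; for the update, cases
    on [i] arise only when the sign is checked. *)
Lemma is_derive_coord (C : int -> R) (i k : int) :
  is_derive (C i) 1 (fun x => if k == i then x else C k) (k == i)%:R.
Proof. by case: eqP => _; [exact: is_derive_id | exact: is_derive_cst]. Qed.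

Lemma is_derive_flux_coord (C : int -> R) (i k : int) :
  is_derive (C i) 1 (fun x => F (if k == i then x else C k))
    ((k == i)%:R * derive1 F (C k)).
Proof.
case: eqP => [->|_]; last by rewrite mul0r; exact: is_derive_cst.
by rewrite mul1r derive1E; exact/derivableP/F_diff.
Qed.

Lemma is_derive_affine_flux (p q r s : int -> R) (C : int -> R) (i j : int) :
  is_derive (C i) 1 (section_at (affine_flux p q r s) C i j)
    ((j - 1 == i)%:R * (p j * derive1 F (C (j - 1)) + r j)
     + (j == i)%:R * (q j * derive1 F (C j) + s j)).
Proof.
have dFl := is_derive_flux_coord C i (j - 1).
have dFr := is_derive_flux_coord C i j.
have dl := is_derive_coord C i (j - 1).
have dr := is_derive_coord C i j.
have d := is_deriveD (is_deriveD (is_deriveD (is_deriveZ (p j) dFl)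
  (is_deriveZ (q j) dFr)) (is_deriveZ (r j) dl)) (is_deriveZ (s j) dr).
by apply: is_derive_eq d _; rewrite /GRing.scale /=; ring.
Qed.

Lemma monotone_affine_flux (p q r s : int -> R) (dx dt : R) (C : int -> R) :
  0 <= dt / dx ->
  (forall j, 0 <= p j * derive1 F (C (j - 1)) + r j) ->
  (forall j, q j * derive1 F (C j) + s j <= 0) ->
  (forall j, dt / dx * (p (j + 1) * derive1 F (C j) + r (j + 1)
                        - (q j * derive1 F (C j) + s j)) <= 1) ->
  monotone_at (update dx dt (affine_flux p q r s)) C.
Proof.
move=> lam_ge0 left_ge0 right_le0 diag_le1 i j.
have d := is_deriveB (is_derive_coord C i j) (is_deriveZ (dt / dx)
  (is_deriveB (is_derive_affine_flux p q r s C i (j + 1))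
              (is_derive_affine_flux p q r s C i j))).
rewrite addrK in d.
split; first exact: (@ex_derive _ _ _ _ _ _ _ d).
rewrite derive1E (@derive_val _ _ _ _ _ _ _ d) /GRing.scale /=.
have [ji|jNi] := eqVneq j i.
  have -> : (j + 1 == i) = false by rewrite -ji; lia.
  have -> : (j - 1 == i) = false by rewrite -ji; lia.
  by rewrite !(mul0r, mul1r) addr0 add0r subr_ge0.
have [ji|j1Ni] := eqVneq (j + 1) i.
  have -> : (j - 1 == i) = false by rewrite -ji; lia.
  by rewrite !(mul0r, mul1r) !(add0r, subr0) oppr_ge0 mulr_ge0_le0.
(* The delta of [j - 1 == i] stays symbolic, which covers both the left neighbour and every cell
   outside the stencil. *)
rewrite !mul0r !(add0r, addr0) mulrN opprK.
by apply: mulr_ge0 => //; apply: mulr_ge0.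
Qed.

Lemma sym_fluxE (a : int -> R) :
  sym_flux F a = affine_flux (fun=> 1 / 2) (fun=> 1 / 2)
                   (fun j => a j / 2) (fun j => - (a j / 2)).
Proof.
by apply/funext => C; apply/funext => j; rewrite /sym_flux /affine_flux; field.
Qed.

(** The left flux value keeps the weight [1 + am j / (ap j - am j)], which is
    [ap j / (ap j - am j)]. *)
Lemma opt_fluxE (am ap : int -> R) :
  (forall j, 0 < ap j - am j) ->
  opt_flux F am ap = affine_flux
    (fun j => ap j / (ap j - am j)) (fun j => - am j / (ap j - am j))
    (fun j => - am j / (ap j - am j) * ap j)
    (fun j => - (- am j / (ap j - am j) * ap j)).
Proof.
move=> gap; apply/funext => C; apply/funext => j.
by rewrite /opt_flux /affine_flux; field; rewrite gt_eqF.
Qed.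

End AffineFlux.

(* [f] need not be at most [p]: only the global bound [A] is available for it,
   because the subcharacteristic condition bounds each speed at an interface by
   the derivative on one side only. *)
Lemma opt_slope_bounds (R : realFieldType) (p m f A : R) :
  0 <= p -> 0 <= m -> 0 < p + m -> - m <= f -> p <= A -> f <= A ->
  0 <= p / (p + m) * f + m / (p + m) * p <= A.
Proof.
move=> p0 m0 pm mf pA fA.
have -> : p / (p + m) * f + m / (p + m) * p = p * (f + m) / (p + m).
  by field; rewrite gt_eqF.
(* The upper bound is the sum of [p * f <= p * A] and [p * m <= A * m]. *)
by rewrite divr_ge0 ?mulr_ge0 ?ler_pdivrMr //=; [nra|lra|lra].
Qed.

Theorem theorem3p1 (R : realType) (F : R -> R) (dx dt : R)
    (F_diff : forall x : R, derivable F x 1) (dx_gt0 : 0 < dx) (dt_gt0 : 0 < dt) :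
  (forall (a : int -> R) (C : int -> R),
     (forall j : int, 0 <= a j) ->
     (forall j : int, `|derive1 F (C (j - 1))| <= a j /\ `|derive1 F (C j)| <= a j) ->
     has_ubound (range a) ->
     dt / dx * sym_amax a <= 1 ->
     monotone_at (update dx dt (sym_flux F a)) C)
  /\
  (forall (am ap : int -> R) (C : int -> R),
     (forall j : int, am j <= 0 /\ 0 <= ap j /\ 0 < ap j - am j) ->
     (forall j : int, am j <= Num.min (derive1 F (C (j - 1))) 0 /\
                      Num.max (derive1 F (C j)) 0 <= ap j) ->
     has_ubound (range (opt_speed am ap)) ->
     dt / dx * opt_amax am ap <= 1 / 2 ->
     monotone_at (update dx dt (opt_flux F am ap)) C).
Proof.
have lam_ge0 : 0 <= dt / dx by rewrite divr_ge0 ?ltW.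
split=> [a C a_ge0 subch a_bnd cfl|am ap C speeds subch sp_bnd cfl].
  rewrite sym_fluxE; apply: monotone_affine_flux => // j.
  - have [+ _] := subch j; rewrite ler_norml => /andP[]; lra.
  - have [_] := subch j; rewrite ler_norml => /andP[]; lra.
  (* The supremum of an unbounded set defaults to 0; [a_bnd] makes it a genuine upper bound. *)
  have a_le k : a k <= sym_amax a by apply: ub_le_sup => //; exists k.
  apply: le_trans cfl; rewrite ler_wpM2l //.
  (* The derivative of [F] at [C j] cancels between the two slopes, leaving the mean of [a j] and
     [a (j + 1)]. *)
  have := a_le j; have := a_le (j + 1); lra.
have gap j : 0 < ap j - am j by have [_ []] := speeds j.
have amN j : 0 <= - am j by have [+ _] := speeds j; rewrite oppr_ge0.
have ap0 j : 0 <= ap j by have [_ []] := speeds j.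
have sp_le k : ap k <= opt_amax am ap /\ - am k <= opt_amax am ap.
  have : opt_speed am ap k <= opt_amax am ap by apply: ub_le_sup => //; exists k.
  rewrite /opt_speed ge_max ler_norml => /andP[-> /andP[+ _]].
  by rewrite lerNl.
have am_le j : am j <= derive1 F (C (j - 1)).
  by have [+ _] := subch j; rewrite le_min => /andP[].
have ap_ge j : derive1 F (C j) <= ap j.
  by have [_ +] := subch j; rewrite ge_max => /andP[].
(* [C j] is the right state at interface [j] and the left state at [j + 1], so its derivative is
   bounded above by [ap j] but below by [am (j + 1)]. *)
have am_leS j : am (j + 1) <= derive1 F (C j).
  by have := am_le (j + 1); rewrite addrK.
have left_bounds j : 0 <= ap (j + 1) / (ap (j + 1) - am (j + 1)) * derive1 F (C j)
    + - am (j + 1) / (ap (j + 1) - am (j + 1)) * ap (j + 1) <= opt_amax am ap.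
  apply: opt_slope_bounds => //; first by rewrite opprK.
  - by have [] := sp_le (j + 1).
  - by apply: le_trans (ap_ge j) _; have [] := sp_le j.
(* The right slope is the left slope of the reflected flux: exchange the two
   speeds and change the sign of F'. *)
have right_bounds j : 0 <= - (- am j / (ap j - am j) * derive1 F (C j)
    + - (- am j / (ap j - am j) * ap j)) <= opt_amax am ap.
  have := @opt_slope_bounds _ (- am j) (ap j) (- derive1 F (C j)) (opt_amax am ap).
  rewrite [- am j + ap j]addrC.
  have -> : - (- am j / (ap j - am j) * derive1 F (C j)
      + - (- am j / (ap j - am j) * ap j))
    = - am j / (ap j - am j) * - derive1 F (C j)
      + ap j / (ap j - am j) * - am j by ring.
  apply=> //; first by rewrite lerN2.
  - by have [] := sp_le j.
  - by apply: le_trans (_ : - am (j + 1) <= _); [rewrite lerN2|have [] := sp_le (j + 1)].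
rewrite opt_fluxE //; apply: monotone_affine_flux => // j.
- by have := left_bounds (j - 1); rewrite subrK => /andP[].
- by have /andP[+ _] := right_bounds j; rewrite oppr_ge0.
(* The weights at the two interfaces may differ, so the derivative need not cancel; each slope is
   bounded separately by [opt_amax am ap], whence the factor 2 and the time step bound 1/2. *)
apply: le_trans (_ : dt / dx * (2 * opt_amax am ap) <= 1); last by lra.
rewrite ler_wpM2l //.
by have /andP[_] := left_bounds j; have /andP[_] := right_bounds j; lra.
Qed.
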